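(* The quaternionic Hadamard matrix $$M=\begin{bmatrix}1&q\mathbf i&1&-\mathbf j&-\mathbf j\\ -\mathbf j&1&q\mathbf i&1&-\mathbf j\\ -\mathbf j&-\mathbf j&1&q\mathbf i&1\\ 1&-\mathbf j&-\mathbf j&1&q\mathbf i\\ q\mathbf i&1&-\mathbf j&-\mathbf j&1\end{bmatrix}$$ is not equivalent to any normalized quaternionic Hadamard matrix of order five whose core is circulant and has two complex entries (i.e., at least two of the four entries of the first row of the core lie in $\mathbb C=\mathrm{span}_{\mathbb R}\{1,\mathbf i\}$).
   Context: $\mathbb H$ is the real algebra of quaternions with basic units $\mathbf i,\mathbf j,\mathbf k$ ($\mathbf i\mathbf j=\mathbf k=-\mathbf j\mathbf i$, squares equal to $-1$); $q=(1+\mathbf i+\mathbf j+\mathbf k)/2$. The complex numbers are viewed inside $\mathbb H$ as $\mathrm{span}_{\mathbb R}\{1,\mathbf i\}$. A quaternionic Hadamard matrix (QHM) of order $n$ is an $n\times n$ matrix $G$ with unit-norm quaternion entries such that $GG^*=nI_n$, where $G^*$ is the conjugate transpose. A QHM is normalized if its first row and first column consist entirely of $1$s; the core of a normalized QHM is obtained by deleting its first row and first column. A matrix is circulant if every row is the cyclic shift of the previous row by one position to the right. Two QHMs are equivalent if one can be obtained from the other by multiplying rows on the left by unit quaternions, multiplying columns on the right by unit quaternions, interchanging rows, or interchanging columns. *)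

(* Defs.v *)
From HB Require Import structures.
From mathcomp Require Import all_boot all_order all_algebra.
From mathcomp Require Import reals ring.

Set Implicit Arguments.
Unset Strict Implicit.
Unset Printing Implicit Defensive.

Import Order.TTheory GRing.Theory Num.Theory.
Local Open Scope ring_scope.

(* [Quat a b c d] is the quaternion a + b i + c j + d k. *)
Record quat (R : Type) : Type := Quat { q_re : R; q_i : R; q_j : R; q_k : R }.

Section QuatChoice.
Variable R : Type.

Definition quat_to_prod (x : quat R) : R * R * R * R :=
  let: Quat a b c d := x in (a, b, c, d).
Definition quat_of_prod (t : R * R * R * R) : quat R :=
  let: (a, b, c, d) := t in Quat a b c d.

Lemma quat_to_prodK : cancel quat_to_prod quat_of_prod.
Proof. by case. Qed.

End QuatChoice.

HB.instance Definition _ (R : eqType) :=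
  Equality.copy (quat R) (can_type (@quat_to_prodK R)).
HB.instance Definition _ (R : choiceType) :=
  Choice.copy (quat R) (can_type (@quat_to_prodK R)).

Section QuatRing.
Variable R : comNzRingType.
Implicit Types x y z : quat R.

Definition addq x y : quat R :=
  let: Quat a b c d := x in let: Quat a' b' c' d' := y in
  Quat (a + a') (b + b') (c + c') (d + d').

Definition oppq x : quat R :=
  let: Quat a b c d := x in Quat (- a) (- b) (- c) (- d).

Definition scaleq (r : R) x : quat R :=
  let: Quat a b c d := x in Quat (r * a) (r * b) (r * c) (r * d).

Definition mulq x y : quat R :=
  let: Quat a b c d := x in let: Quat a' b' c' d' := y in
  Quat (a * a' - b * b' - c * c' - d * d')
       (a * b' + b * a' + c * d' - d * c')
       (a * c' - b * d' + c * a' + d * b')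
       (a * d' + b * c' - c * b' + d * a').

Local Notation zeroq := (Quat 0 0 0 0 : quat R).
Local Notation oneq := (Quat 1 0 0 0 : quat R).

Fact addqA : associative addq.
Proof. by move=> [????] [????] [????] /=; congr Quat; ring. Qed.
Fact addqC : commutative addq.
Proof. by move=> [????] [????] /=; congr Quat; ring. Qed.
Fact add0q : left_id zeroq addq.
Proof. by move=> [????] /=; congr Quat; ring. Qed.
Fact addNq : left_inverse zeroq oppq addq.
Proof. by move=> [????] /=; congr Quat; ring. Qed.

HB.instance Definition _ :=
  GRing.isZmodule.Build (quat R) addqA addqC add0q addNq.

Fact mulqA : associative mulq.
Proof. by move=> [????] [????] [????] /=; congr Quat; ring. Qed.
Fact mul1q : left_id oneq mulq.
Proof. by move=> [????] /=; congr Quat; ring. Qed.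
Fact mulq1 : right_id oneq mulq.
Proof. by move=> [????] /=; congr Quat; ring. Qed.
Fact mulqDl : left_distributive mulq addq.
Proof. by move=> [????] [????] [????] /=; congr Quat; ring. Qed.
Fact mulqDr : right_distributive mulq addq.
Proof. by move=> [????] [????] [????] /=; congr Quat; ring. Qed.
Fact oneq_neq0 : oneq != 0 :> quat R.
Proof. by apply/eqP => -[/eqP]; rewrite oner_eq0. Qed.

HB.instance Definition _ := GRing.Zmodule_isNzRing.Build (quat R)
  mulqA mul1q mulq1 mulqDl mulqDr oneq_neq0.

Fact scaleqA a b x : scaleq a (scaleq b x) = scaleq (a * b) x.
Proof. by case: x => ???? /=; congr Quat; ring. Qed.
Fact scale1q : left_id 1 scaleq.
Proof. by move=> [????] /=; congr Quat; ring. Qed.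
Fact scaleqDr : right_distributive scaleq +%R.
Proof. by move=> ? [????] [????]; congr Quat; ring. Qed.
Fact scaleqDl x : {morph scaleq^~ x : a b / a + b}.
Proof. by move=> a b; case: x => ????; congr Quat; ring. Qed.

HB.instance Definition _ := GRing.Zmodule_isLmodule.Build R (quat R)
  scaleqA scale1q scaleqDr scaleqDl.

Fact scaleqAl (a : R) x y : a *: (x * y) = (a *: x) * y.
Proof. by case: x => ????; case: y => ????; congr Quat; ring. Qed.
Fact scaleqAr (a : R) x y : a *: (x * y) = x * (a *: y).
Proof. by case: x => ????; case: y => ????; congr Quat; ring. Qed.

HB.instance Definition _ :=
  GRing.Lmodule_isLalgebra.Build R (quat R) scaleqAl.
HB.instance Definition _ :=
  GRing.Lalgebra_isAlgebra.Build R (quat R) scaleqAr.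

Definition iq : quat R := Quat 0 1 0 0.
Definition jq : quat R := Quat 0 0 1 0.
Definition kq : quat R := Quat 0 0 0 1.

Fact iq_sqr : iq * iq = -1.
Proof. by congr Quat; ring. Qed.
Fact jq_sqr : jq * jq = -1.
Proof. by congr Quat; ring. Qed.
Fact kq_sqr : kq * kq = -1.
Proof. by congr Quat; ring. Qed.
Fact iq_jq : iq * jq = kq.
Proof. by congr Quat; ring. Qed.
Fact jq_iq : jq * iq = - kq.
Proof. by congr Quat; ring. Qed.

Definition conjq x : quat R :=
  let: Quat a b c d := x in Quat a (- b) (- c) (- d).

Definition complexq x : Prop := exists a b : R, x = a%:A + b *: iq.

End QuatRing.

Arguments iq {R}.
Arguments jq {R}.
Arguments kq {R}.

Section QuatHadamard.
Variable R : realType.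

Definition normq (x : quat R) : R :=
  Num.sqrt (q_re x ^+ 2 + q_i x ^+ 2 + q_j x ^+ 2 + q_k x ^+ 2).

Definition unitq (x : quat R) : Prop := normq x = 1.

Definition adjmxq m n (G : 'M[quat R]_(m, n)) : 'M[quat R]_(n, m) :=
  (map_mx (@conjq R) G)^T.

Definition is_QHM n (G : 'M[quat R]_n) : Prop :=
  (forall i j, unitq (G i j)) /\ G *m adjmxq G = n%:R%:M.

Definition normalized n (G : 'M[quat R]_n.+1) : Prop :=
  (forall j, G ord0 j = 1) /\ (forall i, G i ord0 = 1).

Definition core n (G : 'M[quat R]_n.+1) : 'M[quat R]_n :=
  row' ord0 (col' ord0 G).

(* [ordS] is the cyclic successor j |-> j + 1 mod n on column indices. *)
Definition circulant n (A : 'M[quat R]_n) : Prop :=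
  forall i i' j : 'I_n, i' = i.+1 :> nat -> A i' (ordS j) = A i j.

Inductive QHM_equiv n (G : 'M[quat R]_n) : 'M[quat R]_n -> Prop :=
| QHM_equiv_refl : QHM_equiv G G
| QHM_equiv_scale_row H (i0 : 'I_n) (u : quat R) :
    QHM_equiv G H -> unitq u ->
    QHM_equiv G (\matrix_(i, j) if i == i0 then u * H i j else H i j)
| QHM_equiv_scale_col H (j0 : 'I_n) (u : quat R) :
    QHM_equiv G H -> unitq u ->
    QHM_equiv G (\matrix_(i, j) if j == j0 then H i j * u else H i j)
| QHM_equiv_xrow H (i1 i2 : 'I_n) :
    QHM_equiv G H -> QHM_equiv G (xrow i1 i2 H)
| QHM_equiv_xcol H (j1 j2 : 'I_n) :
    QHM_equiv G H -> QHM_equiv G (xcol j1 j2 H).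

Definition qq : quat R := 2^-1 *: (1 + iq + jq + kq).

Definition rows_M : seq (seq (quat R)) :=
  [:: [:: 1;       qq * iq; 1;       - jq;    - jq   ];
      [:: - jq;    1;       qq * iq; 1;       - jq   ];
      [:: - jq;    - jq;    1;       qq * iq; 1      ];
      [:: 1;       - jq;    - jq;    1;       qq * iq];
      [:: qq * iq; 1;       - jq;    - jq;    1      ]].

Definition M : 'M[quat R]_5 := \matrix_(i, j) (nth [::] rows_M i)`_j.

End QuatHadamard.

Arguments qq {R}.

(* Main.v *)
Require Import Defs.
From mathcomp Require Import all_boot all_order all_algebra.
From mathcomp Require Import fingroup perm reals ring.

(** Scaling normalises an equivalent copy of [M] to the matrix with entries
  [M a b * (M x b)^* * M x y * (M a y)^*], up to permuting rows and columns and
  conjugating all entries by one unit quaternion, where row [a] and column [b]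
  of [M] become the first row and column.  All rows of a circulant core have
  the same set of entries; but for each of the 25 choices of [(a, b)] some entry
  of the core is missing from some other row.  The latter is a computation with
  integer quaternions, the entries of [2 M] being integral. *)

Import Order.TTheory GRing.Theory Num.Theory.
Local Open Scope ring_scope.

Section QuatTheory.
Context {R : comNzRingType}.
Implicit Types x y : quat R.

Lemma conjqM x y : conjq (x * y) = conjq y * conjq x.
Proof. by case: x y => [????] [????]; congr Quat; ring. Qed.

Lemma conjqZ (a : R) x : conjq (a *: x) = a *: conjq x.
Proof. by case: x => [????]; congr Quat; ring. Qed.

Lemma mulq_conjE x :
  x * conjq x = Quat (q_re x ^+ 2 + q_i x ^+ 2 + q_j x ^+ 2 + q_k x ^+ 2) 0 0 0.
Proof. by case: x => [????]; congr Quat => /=; ring. Qed.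

Lemma conjq_mulE x : conjq x * x = x * conjq x.
Proof. by case: x => [????]; congr Quat => /=; ring. Qed.

End QuatTheory.

(** For [f = intr] this carries integer quaternions, whose equality is decided by computation, into
    [quat R]. *)
Definition map_quat {R S : Type} (f : R -> S) (x : quat R) : quat S :=
  let: Quat a b c d := x in Quat (f a) (f b) (f c) (f d).

Section MapQuat.
Context {R S : comNzRingType} (f : {rmorphism R -> S}).
Implicit Types x y : quat R.
Local Notation mq := (map_quat f).

Lemma map_quatD x y : mq (x + y) = mq x + mq y.
Proof. by case: x y => [????] [????] /=; congr Quat; rewrite rmorphD. Qed.

Lemma map_quatM x y : mq (x * y) = mq x * mq y.
Proof.
by case: x y => [????] [????] /=; congr Quat; rewrite !(rmorphB, rmorphD, rmorphM).
Qed.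

Lemma map_quat_conj x : mq (conjq x) = conjq (mq x).
Proof. by case: x => [????]; congr Quat; rewrite ?rmorphN. Qed.

Lemma map_quat_inj : injective f -> injective mq.
Proof. by move=> fI [????] [????] [/fI-> /fI-> /fI-> /fI->]. Qed.

End MapQuat.

Lemma circulant_rows (R : realType) n (A : 'M[quat R]_n) (i i' j : 'I_n) :
  circulant A -> exists j', A i' j' = A i j.
Proof.
case: n A i i' j => [? []|n A i i' j circA] //.
(* [circulant] links consecutive rows without wrapping round from the last to the first, so every
   row is compared with row [ord0]. *)
have shift k : forall l, A k (iter k (@ordS _) l) = A ord0 l.
  case: k => k; elim: k => [|k IHk] ltk l /=; first by congr (A _ _); apply/val_inj.
  by rewrite (circA (Ordinal (ltnW ltk))) ?IHk.
have [l ->] : exists l, j = iter i (@ordS _) l.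
  elim: (i : nat) => [|k [l ->]]; first by exists j.
  by exists (ord_pred l); rewrite iterSr ord_predK.
by exists (iter i' (@ordS _) l); rewrite !shift.
Qed.

Section Equivalence.
Context {R : realType}.
Implicit Types x : quat R.

(** Trades the square root in [normq] for a polynomial identity; from right to left, the norm is the
    nonnegative root of 1. *)
Lemma unitqP x : unitq x <-> x * conjq x = 1.
Proof.
have xE : x * conjq x = Quat (Defs.normq x ^+ 2) 0 0 0.
  rewrite mulq_conjE; congr Quat; apply/esym/sqr_sqrtr.
  by do 3?[apply: addr_ge0]; apply: sqr_ge0.
rewrite xE /unitq; split=> [->|[/eqP]]; first by rewrite expr1n.
by rewrite sqrp_eq1 ?sqrtr_ge0 // => /eqP.
Qed.

Lemma unitq1 : unitq (1 : quat R).
Proof. by apply/unitqP; congr Quat => /=; ring. Qed.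

Lemma unitqM x y : unitq x -> unitq y -> unitq (x * y).
Proof.
move=> /unitqP xx /unitqP yy; apply/unitqP.
by rewrite conjqM mulrA -(mulrA x) yy mulr1.
Qed.

(** Row factors gather on the left and column factors on the right, so every move preserves this
    form; a swap also reindexes the factors. *)
Lemma QHM_equivP n (G H : 'M[quat R]_n) : QHM_equiv G H ->
  exists (s t : 'S_n) (u v : 'I_n -> quat R),
    [/\ forall i, unitq (u i), forall j, unitq (v j)
      & forall i j, H i j = u i * G (s i) (t j) * v j].
Proof.
elim=> [|K i0 w _ [s [t [u [v [Uu Uv KE]]]]] Uw
        |K j0 w _ [s [t [u [v [Uu Uv KE]]]]] Uw
        |K i1 i2 _ [s [t [u [v [Uu Uv KE]]]]]
        |K j1 j2 _ [s [t [u [v [Uu Uv KE]]]]]].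
- exists 1%g, 1%g, (fun=> 1), (fun=> 1).
  by split=> *; rewrite ?perm1 ?mul1r ?mulr1 //; apply: unitq1.
- exists s, t, (fun i => if i == i0 then w * u i else u i), v; split=> // i.
    by case: ifP => // _; apply: unitqM.
  by move=> j; rewrite mxE KE; case: ifP; rewrite ?mulrA.
- exists s, t, u, (fun j => if j == j0 then v j * w else v j); split=> // j.
    by case: ifP => // _; apply: unitqM.
  by move=> k; rewrite mxE KE; case: ifP; rewrite ?mulrA.
- exists (tperm i1 i2 * s)%g, t, (fun i => u (tperm i1 i2 i)), v.
  by split=> // i j; rewrite mxE KE permM.
- exists s, (tperm j1 j2 * t)%g, u, (fun j => v (tperm j1 j2 j)).
  by split=> // i j; rewrite mxE KE permM.
Qed.

(** The ones in the first row and column of [H] express all factors through [u ord0], which survives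
    as the conjugating unit [w]. *)
Lemma normalized_equivP n (G H : 'M[quat R]_n.+1) :
    (forall i j, unitq (G i j)) -> normalized H -> QHM_equiv G H ->
  exists (s t : 'S_n.+1) (w : quat R), forall i j,
    G (s ord0) (t ord0) * conjq (G (s i) (t ord0))
      * G (s i) (t j) * conjq (G (s ord0) (t j)) = conjq w * H i j * w.
Proof.
move=> UG [row1 col1] /QHM_equivP[s [t [u [v [Uu Uv HE]]]]].
have conjKl x : unitq x -> conjq x * x = 1 by rewrite conjq_mulE => /unitqP.
exists s, t, (u ord0) => i j.
have solve_v k l : H k l = 1 -> v l = conjq (G (s k) (t l)) * conjq (u k).
  rewrite HE -conjqM => /(congr1 ( *%R (conjq (u k * G (s k) (t l))))).
  by rewrite mulrA conjKl ?mul1r ?mulr1 //; apply: unitqM.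
have solve_u k l : H k l = 1 -> u k = conjq (v l) * conjq (G (s k) (t l)).
  rewrite HE -mulrA -conjqM => /(congr1 ( *%R^~ (conjq (G (s k) (t l) * v l)))).
  move/unitqP: (unitqM (G (s k) (t l)) (v l) (UG _ _) (Uv _)) => e.
  by rewrite -mulrA e mul1r mulr1.
have conjqK x : conjq (conjq x) = x by case: x => *; rewrite /= !opprK.
rewrite HE (solve_v _ _ (row1 j)) (solve_u _ _ (col1 i)).
rewrite (solve_v _ _ (row1 ord0)) conjqM !conjqK.
by rewrite !mulrA conjKl // mul1r -[in RHS]mulrA conjKl // mulr1.
Qed.

End Equivalence.

(** This is [2 M], with [Quat (-1) 1 1 (-1)] standing for [2 q i]. As [M] is circulant, only [y - x]
    modulo 5 matters; the added 5 avoids truncated subtraction. *)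
Definition M2 (x y : nat) : quat int :=
  nth 0 [:: Quat 2 0 0 0; Quat (-1) 1 1 (-1); Quat 2 0 0 0;
            Quat 0 0 (-2) 0; Quat 0 0 (-2) 0] ((5 + y - x) %% 5).

Definition core2 (a b x y : nat) : quat int :=
  M2 a b * conjq (M2 x b) * M2 x y * conjq (M2 a y).

Lemma core2_rows_differ (a b : 'I_5) : exists x y x' : 'I_5,
  [/\ x != a, y != b, x' != a & forall y' : 'I_5, core2 a b x' y' != core2 a b x y].
Proof.
(* Over [nat] and explicit lists the claim becomes a closed boolean that [vm_compute] can
   evaluate. *)
pose differ (a b x y x' : nat) := [&& x != a, y != b, x' != a
  & all (fun y' => core2 a b x' y' != core2 a b x y) (iota 0 5)].
pose r := iota 0 5.
have: all (fun a => all (fun b =>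
   has (fun x => has (fun y => has (differ a b x y) r) r) r) r) r.
  by vm_compute.
have inr (i : 'I_5) : (i : nat) \in r by rewrite mem_iota /= ltn_ord.
move=> /allP/(_ _ (inr a))/allP/(_ _ (inr b)).
case/hasP=> x; rewrite mem_iota => ltx /hasP[y]; rewrite mem_iota => lty.
case/hasP=> x'; rewrite mem_iota => ltx' /and4P[xa yb x'a /allP ne].
by exists (Ordinal ltx), (Ordinal lty), (Ordinal ltx'); split=> // y'; apply: ne (inr y').
Qed.

Section MatrixM.
Context {R : realType}.
Local Notation toR := (map_quat (intr : int -> R)).

Lemma M2E (x y : 'I_5) : toR (M2 x y) = 2 *: M R x y.
Proof.
rewrite mxE; case: x => -[|[|[|[|[|//]]]]] ?; case: y => -[|[|[|[|[|//]]]]] ?.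
all: by congr Quat => //=; rewrite ?rmorphN; field.
Qed.

Lemma M2_mul_conjE (x y x' y' : 'I_5) :
  toR (M2 x y * conjq (M2 x' y')) = 4 *: (M R x y * conjq (M R x' y')).
Proof.
by rewrite map_quatM map_quat_conj !M2E conjqZ -scalerAl -scalerAr scalerA -natrM.
Qed.

Lemma core2E (a b x y : 'I_5) : toR (core2 a b x y) =
  16 *: (M R a b * conjq (M R x b) * M R x y * conjq (M R a y)).
Proof.
rewrite /core2 -mulrA map_quatM !M2_mul_conjE -scalerAl -scalerAr scalerA -natrM.
by rewrite !mulrA.
Qed.

Lemma unitq_M (x y : 'I_5) : unitq (M R x y).
Proof.
apply/unitqP/(@scalerI _ _ (4 : R)); first by rewrite pnatr_eq0.
have -> : 4%:A = toR (Quat 4 0 0 0) by congr Quat => /=; ring.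
rewrite -M2_mul_conjE; congr toR.
by case: x => -[|[|[|[|[|//]]]]] ?; case: y => -[|[|[|[|[|//]]]]].
Qed.

(** Multiplying the Gram matrix by 4 clears the denominators, which leaves 25 sums in [quat int] to
    evaluate. *)
Lemma is_QHM_M : is_QHM (M R).
Proof.
split; first exact: unitq_M.
apply/matrixP=> x y; apply: (@scalerI _ _ (4 : R)); first by rewrite pnatr_eq0.
rewrite mxE [X in _ = _ *: X]mxE scaler_sumr.
have gram k : 4 *: (M R x k * adjmxq (M R) k y) = toR (M2 x k * conjq (M2 y k)).
  by rewrite M2_mul_conjE [adjmxq _ _ _]mxE [map_mx _ _ _ _]mxE.
under eq_bigr => k _ do rewrite gram.
rewrite -(big_morph _ (map_quatD intr) (erefl : toR 0 = 0)).
have -> : 4 *: (5%:R *+ (x == y)) = toR (Quat (20 *+ (x == y)) 0 0 0).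
  by case: (x == y); congr Quat => /=; ring.
congr toR; rewrite {gram} !big_ord_recl big_ord0.
by case: x => -[|[|[|[|[|//]]]]] ?; case: y => -[|[|[|[|[|//]]]]].
Qed.

End MatrixM.

Theorem proposition22 (R : realType) :
  is_QHM (M R) /\
  (forall H : 'M[quat R]_5,
     is_QHM H -> normalized H -> circulant (core H) ->
     (exists j1 j2 : 'I_4,
        [/\ j1 != j2, complexq (core H ord0 j1) & complexq (core H ord0 j2)]) ->
     ~ QHM_equiv (M R) H).
Proof.
split=> [|H _ nH circH _ /(normalized_equivP _ _ _ unitq_M nH)]; first exact: is_QHM_M.
case=> s [t [w HE]].
have [x [y [x' [xa yb x'a]]]] := core2_rows_differ (s ord0) (t ord0).
(* Rows and columns of [M] away from the normalising ones correspond to indices of the core of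
   [H]. *)
have lift_perm0 (p : 'S_5) z : z != p ord0 -> exists k, z = p (lift ord0 k).
  move=> zp; have: ord0 != p^-1%g z by apply: contra zp => /eqP->; rewrite permKV.
  by case/unlift_some=> k pz _; exists k; rewrite -pz permKV.
case: (lift_perm0 _ _ xa) => k ->; case: (lift_perm0 _ _ yb) => l ->.
case: (lift_perm0 _ _ x'a) => k' -> differ.
have [l'] := circulant_rows _ _ _ k k' l circH; rewrite !mxE => eqH.
have /eqP[] := differ (t (lift ord0 l')).
(* Both values, sent to [quat R], are 16 times the conjugates by [w] of two equal core entries of
   [H]; injectivity brings the equality back to [quat int]. *)
by apply: (map_quat_inj _ (@intr_inj R)); rewrite !core2E !HE eqH.
Qed.
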